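(* Let $n\ge1$ and $\ell\ge1$, let $C_{\lambda,\mu}$ be a conjugacy class of $B_n$ with no cycles of length $1,2,\ldots,2\ell$, and let $B_n(t)=\sum_{\omega\in B_n}t^{\operatorname{des}_B(\omega)+1}$ and $B_{\lambda,\mu}(t)=\sum_{\omega\in C_{\lambda,\mu}}t^{\operatorname{des}_B(\omega)+1}$. Then there is a polynomial $g(t)$ such that \[\frac{B_{\lambda,\mu}(t)}{|C_{\lambda,\mu}|}=\frac{B_n(t)}{2^nn!}+(1-t)^{\ell+1}g(t).\]
   Context: $B_n$ is the group of permutations $\omega$ of $\{\pm1,\dots,\pm n\}$ with $\omega(-i)=-\omega(i)$ (order $2^nn!$); $\operatorname{des}_B(\omega)=|\{i\in\{0,\dots,n-1\}:\omega(i)>\omega(i+1)\}|$ with $\omega(0)=0$. A cycle of $\omega$ is a cycle of $|\omega|:i\mapsto|\omega(i)|$, with length its length; it is even (odd) if the number of its elements $i$ with $\omega(i)<0$ is even (odd). The cycle type is the bi-partition $(\lambda,\mu)$ with $\lambda$ the lengths of even cycles, $\mu$ those of odd cycles, and $C_{\lambda,\mu}$ is the conjugacy class of that type. *)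

(* Defs.v *)
From HB Require Import structures.
From mathcomp Require Import all_boot all_order all_algebra all_fingroup.
Set Implicit Arguments.
Unset Strict Implicit.
Unset Printing Implicit Defensive.
Import Order.TTheory GRing.Theory Num.Theory.
Local Open Scope ring_scope.

(* The set {+-1, ..., +-n}: (false, i) stands for i + 1 and (true, i) for
   -(i + 1), where i : 'I_n, as made explicit by [spt_int]. *)
Definition spt (n : nat) : finType := (bool * 'I_n)%type.

Definition spt_int (n : nat) (x : spt n) : int :=
  if x.1 then - (x.2.+1)%:Z else (x.2.+1)%:Z.

Definition spt_opp (n : nat) (x : spt n) : spt n := (~~ x.1, x.2).

Definition spt_pos (n : nat) (i : 'I_n) : spt n := (false, i).

Lemma spt_int_opp (n : nat) (x : spt n) : spt_int (spt_opp x) = - spt_int x.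
Proof. by case: x => [[] i]; rewrite /spt_int //= opprK. Qed.

Definition hyperoct (n : nat) : {set {perm (spt n)}} :=
  [set w : {perm (spt n)} | [forall x, w (spt_opp x) == spt_opp (w x)]].

Lemma hyperoctP (n : nat) (w : {perm (spt n)}) :
  reflect (forall x, w (spt_opp x) = spt_opp (w x)) (w \in hyperoct n).
Proof. by rewrite inE; apply: (iffP forallP) => H x; apply/eqP. Qed.

Lemma hyperoct_group_set (n : nat) : group_set (hyperoct n).
Proof.
apply/group_setP; split; first by apply/hyperoctP => x; rewrite !perm1.
move=> u v /hyperoctP Hu /hyperoctP Hv.
by apply/hyperoctP => x; rewrite !permM Hu Hv.
Qed.

Canonical hyperoct_group (n : nat) : {group {perm (spt n)}} :=
  Group (hyperoct_group_set n).

(* The value w(i) for i = 0, 1, ..., n, with w(0) = 0; it is also 0 for the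
   irrelevant indices i > n. *)
Definition sval_at (n : nat) (w : {perm (spt n)}) (i : nat) : int :=
  if i is j.+1 then
    if insub j is Some k then spt_int (w (spt_pos k)) else 0
  else 0.

Definition desB (n : nat) (w : {perm (spt n)}) : nat :=
  #|[set i : 'I_n | sval_at w i.+1 < sval_at w i]|.

(* The permutation |w| : i |-> |w(i)|.  The default value 1 is never used for
   w in the hyperoctahedral group, see [abs_permE]. *)
Definition abs_perm (n : nat) (w : {perm (spt n)}) : {perm 'I_n} :=
  insubd (1%g : {perm 'I_n}) [ffun i => (w (spt_pos i)).2].

Lemma abs_permE (n : nat) (w : {perm (spt n)}) (i : 'I_n) :
  w \in hyperoct n -> abs_perm w i = (w (spt_pos i)).2.
Proof.
move=> /hyperoctP Hw; rewrite /abs_perm -pvalE val_insubd ifT ?ffunE //.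
apply/injectiveP => j k; rewrite !ffunE => E.
have [|N] := eqVneq (w (spt_pos j)).1 (w (spt_pos k)).1 => [E1|].
  have: w (spt_pos j) = w (spt_pos k).
    by move: E E1; case: (w _) => a b; case: (w _) => c d /= -> ->.
  by move=> /perm_inj [].
have: w (spt_pos j) = w (spt_opp (spt_pos k)).
  rewrite Hw; move: E N; case: (w _) => a b; case: (w _) => c d /= ->.
  by rewrite /spt_opp /=; case: a; case: c.
by move=> /perm_inj.
Qed.

Definition cycles (n : nat) (w : {perm (spt n)}) : {set {set 'I_n}} :=
  porbits (abs_perm w).

Definition odd_cycle (n : nat) (w : {perm (spt n)}) (c : {set 'I_n}) : bool :=
  odd #|[set i in c | spt_int (w (spt_pos i)) < 0]|.

(* The bi-partition (lambda, mu), as weakly decreasing sequences. *)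
Definition cycle_type (n : nat) (w : {perm (spt n)}) : seq nat * seq nat :=
  (sort geq [seq #|c| | c : {set 'I_n} <- enum (cycles w) & ~~ odd_cycle w c],
   sort geq [seq #|c| | c : {set 'I_n} <- enum (cycles w) & odd_cycle w c]).

Definition conj_class_of_type (n : nat) (lam mu : seq nat)
    (C : {set {perm (spt n)}}) : Prop :=
  C \in classes (hyperoct n) /\ {in C, forall w, cycle_type w = (lam, mu)}.

Definition desB_poly (n : nat) (A : {set {perm (spt n)}}) : {poly rat} :=
  \sum_(w in A) 'X^((desB w).+1).

(* Main.v *)
Require Import Defs.
From mathcomp Require Import all_boot all_order all_algebra all_fingroup.
From mathcomp Require Import zify ring lra.
Set Implicit Arguments.
Unset Strict Implicit.
Unset Printing Implicit Defensive.
Import Order.TTheory GRing.Theory Num.Theory.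
Local Open Scope ring_scope.

(* Expanding t^des = ((t - 1) + 1)^des, it suffices that for every set D of at
   most l positions, the proportion of w with a descent at each position of D
   is the same in C as in B_n.  The set D cuts {+-1, ..., +-n} into intervals
   (blocks) on each of which w must be decreasing; let W be the subgroup of B_n
   stabilising every block.  For any w in B_n exactly one s in W makes s^-1 w
   decreasing on the blocks.  The same holds for the conjugate of w by s when
   no cycle of w stays inside the at most 2 l points lying in nontrivial
   blocks: the relative order of s(x) and s(y) must be opposite to that of
   s(w(x)) and s(w(y)), and so on along the orbits until these enter different
   blocks.  In both cases double counting gives the proportion 1 / |W|. *)

(** * Ranks and sorting permutations of a finite type *)

Section Ranks.
Variables (d : Order.disp_t) (T : finType) (R : orderType d).
Implicit Type f : T -> R.

Definition rank f (x : T) : nat := #|[set y | (f y < f x)%O]|.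

Lemma ltn_rank f x y : (rank f x < rank f y)%N = (f x < f y)%O.
Proof.
have [fxy | fyx] := ltP (f x) (f y).
  apply/proper_card/properP; split.
    by apply/subsetP => z; rewrite !inE => /lt_trans; apply.
  by exists x; rewrite inE ?ltxx.
apply/negbTE; rewrite -leqNgt; apply/subset_leq_card/subsetP => z.
by rewrite !inE => /lt_le_trans; apply.
Qed.

Lemma rank_inj f : injective f -> injective (rank f).
Proof.
move=> fI x y E; apply: fI; apply/eqP; rewrite eq_le !leNgt -!ltn_rank E ltnn.
by [].
Qed.

Lemma rank_lt f x : (rank f x < #|T|)%N.
Proof.
rewrite -cardsT; apply/proper_card/properP; split; first exact: subsetT.
by exists x; rewrite ?inE ?ltxx.
Qed.

End Ranks.

(** Ranks under injective [k] and [e] are bijections onto ['I_#|T|], so [s] can send each point to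
    the one whose [e]-rank is its [k]-rank. *)
Lemma sorting_perm_exists d d' (T : finType) (R : orderType d)
    (R' : orderType d') (k : T -> R) (e : T -> R') :
  injective k -> injective e ->
  exists s : {perm T}, forall x y, (k x < k y)%O = (e (s x) < e (s y))%O.
Proof.
move=> kI eI.
pose rk x := Ordinal (rank_lt k x).
pose re x := Ordinal (rank_lt e x).
have rkI : injective rk by move=> x y /(congr1 val) /rank_inj; apply.
have reI : injective re by move=> x y /(congr1 val) /rank_inj; apply.
have [g reK gK] : bijective re by apply: inj_card_bij => //; rewrite card_ord.
have sI : injective (g \o rk) by apply: inj_comp rkI; apply: can_inj gK.
exists (perm sI) => x y; rewrite !permE /= -!ltn_rank.
have E z : rank e (g (rk z)) = rank k z by rewrite -[LHS]/(val (re _)) gK.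
by rewrite !E.
Qed.

(** Any sorting permutation turns [k]-ranks into [e]-ranks, and an injective [e] determines a point
    by its rank. *)
Lemma sorting_perm_unique d d' (T : finType) (R : orderType d)
    (R' : orderType d') (k : T -> R) (e : T -> R') (s t : {perm T}) :
  injective e ->
  (forall x y, (k x < k y)%O = (e (s x) < e (s y))%O) ->
  (forall x y, (k x < k y)%O = (e (t x) < e (t y))%O) -> s = t.
Proof.
move=> eI Hs Ht; apply/permP => x; apply: (rank_inj eI).
have E (u : {perm T}) :
    (forall x y, (k x < k y)%O = (e (u x) < e (u y))%O) -> rank e (u x) = rank k x.
  move=> Hu; rewrite /rank -[RHS](card_imset _ (@perm_inj _ u)); apply: eq_card => y.
  apply/idP/imsetP => [|[z + ->]]; rewrite !inE ?Hu //.
  by move=> H; exists ((u^-1)%g y); rewrite ?inE ?Hu permKV.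
by rewrite !E.
Qed.

(** * Sorting signed points within blocks *)

Lemma spt_int_inj n : injective (@spt_int n).
Proof.
move=> [a i] [b j]; rewrite /spt_int /=.
case: a; case: b => // E; try by exfalso; move: E; lia.
  by congr (_, _); apply: ord_inj; move: E; lia.
by congr (_, _); apply: ord_inj; move: E; lia.
Qed.

Lemma spt_oppK n : involutive (@spt_opp n).
Proof. by case=> a i; rewrite /spt_opp /= negbK. Qed.

(** The global sorting permutation already works: uniqueness makes it commute with negation, and
    counting points makes it preserve [b]. *)
Lemma block_sorting_perm n (b : spt n -> int) (k : spt n -> rat) :
  (forall x, b (spt_opp x) = - b x) ->
  (forall x y, spt_int x < spt_int y -> b x <= b y) ->
  injective k ->
  (forall x, k (spt_opp x) = - k x) ->
  (forall x y, b x < b y -> k x < k y) ->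
  exists2 s : {perm spt n}, s \in hyperoct n &
    (forall x, b (s x) = b x) /\
    (forall x y, (k x < k y) = (spt_int (s x) < spt_int (s y))).
Proof.
move=> bN bM kI kN bk.
have [s Hs] := sorting_perm_exists kI (@spt_int_inj n).
have sN x : s (spt_opp x) = spt_opp (s x).
  (* Conjugating [s] by negation again sorts the odd key [k], so the result is [s] itself. *)
  have tI : injective (fun x => spt_opp (s (spt_opp x))).
    apply: inj_comp (can_inj (@spt_oppK n)) _.
    exact: inj_comp (@perm_inj _ s) (can_inj (@spt_oppK n)).
  have E : s = perm tI.
    apply: (sorting_perm_unique (k := k) (@spt_int_inj n)) => // y z.
    by rewrite !permE !spt_int_opp ltrN2 -Hs !kN ltrN2.
  by rewrite {2}E permE spt_oppK.
have sH : s \in hyperoct n by apply/hyperoctP.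
exists s => //; split=> //.
(* If [s] lowered the block of [x], it would inject the points of key at most [k x] into those of
   block below [b x], a strictly smaller set because it misses [x]. Raising is excluded afterwards
   by applying this to the opposite point. *)
have nlt x : ~~ (b (s x) < b x).
  apply/negP => bx.
  have: (#|[set y | (b y < b x)%R]| < #|[set y | (k y <= k x)%R]|)%N.
    apply/proper_card/properP; split; last by exists x; rewrite inE ?lexx ?ltxx.
    by apply/subsetP => y; rewrite !inE => /bk /ltW.
  rewrite ltnNge => /negP; apply.
  rewrite -(card_imset _ (@perm_inj _ s)); apply/subset_leq_card/subsetP => z.
  case/imsetP => y; rewrite !inE leNgt Hs -leNgt => H ->.
  apply: le_lt_trans bx; move: H; rewrite le_eqVlt => /orP[/eqP/spt_int_inj -> //|].
  exact: bM.
move=> x; apply/eqP; rewrite eq_le !leNgt nlt andbT.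
by have := nlt (spt_opp x); rewrite sN !bN ltrN2.
Qed.

(** * A key alternating along the orbits of a signed permutation *)

Lemma hyperoct_expg n (w : {perm spt n}) i x :
  w \in hyperoct n -> (w ^+ i)%g (spt_opp x) = spt_opp ((w ^+ i)%g x).
Proof. by move=> wH; apply/hyperoctP; apply: groupX. Qed.

(* The key is the geometric series [b u - eps b (w u) + eps^2 b (w^2 u) - ...],
   summed exactly using that [w] has finite order. *)
Lemma alternating_key n (w : {perm spt n}) (b : spt n -> int) (M : nat) :
  w \in hyperoct n -> (forall x, `|b x| <= M%:Z) ->
  (forall x, b (spt_opp x) = - b x) ->
  exists eps : rat, exists k : spt n -> rat,
  [/\ 0 < eps, forall u, k u = (b u)%:~R - eps * k (w u),
      forall u v, eps * (k u - k v) < 1 & forall x, k (spt_opp x) = - k x].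
Proof.
move=> wH bM bN.
(* The key will be bounded by 2M, so its differences are at most 4M; adding 2 makes [eps] times a
   difference less than 1 and keeps [eps] at most 1/2 even when M is 0. *)
pose eps : rat := (4 * M%:R + 2)^-1.
have M0 : 0 <= M%:R :> rat by apply: ler0n.
have eps0 : 0 < eps by rewrite invr_gt0; lra.
have epsE : eps * (4 * M%:R + 2) = 1 by rewrite mulVf //; apply: lt0r_neq0; lra.
have eps1 : eps <= 1 / 2 by nra.
(* After [N] terms the series repeats with factor [q], so its sum is one period [S] divided by
   [1 - q]. *)
pose N := #[w]%g; pose q := (- eps) ^+ N.
have q1 : 1 - q != 0.
  rewrite subr_eq0; apply/eqP => q1.
  have : `|q| < 1.
    rewrite /q normrX normrN gtr0_norm // exprn_ilt1 ?ltW // -?lt0n ?order_gt0 //.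
    by lra.
  by rewrite -q1 normr1 ltxx.
pose S u : rat := \sum_(i < N) (- eps) ^+ i * (b ((w ^+ i)%g u))%:~R.
pose k u := (1 - q)^-1 * S u.
have kE u : k u = (b u)%:~R - eps * k (w u).
  have E : - eps * S (w u) = S u - (1 - q) * (b u)%:~R.
    rewrite /S mulr_sumr.
    have := @big_ord_recr _ 0 +%R N
      (fun i => (- eps) ^+ i * (b ((w ^+ i)%g u))%:~R : rat).
    rewrite big_ord_recl /= expr0 mul1r expg0 perm1 expg_order perm1 -/q -/(S u).
    move=> /eqP; rewrite addrC -subr_eq => /eqP E.
    rewrite -[LHS]/(\sum_(i < N) _).
    transitivity (S u + q * (b u)%:~R - (b u)%:~R); last by ring.
    rewrite -E subrK addrK; apply: eq_bigr => i _.
    by rewrite /bump /= add1n exprS expgS permM mulrA.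
  have -> : eps * k (w u) = - ((1 - q)^-1 * (- eps * S (w u))) by rewrite /k; ring.
  by rewrite E /k; field.
exists eps, k; split=> //.
  (* At a point [v] maximising the absolute value of [k], the recursion gives |k v| <= M + |k v| /
     2. *)
  have kM u : `|k u| <= 2 * M%:R.
    case: (@arg_maxP _ _ _ u predT (fun v => `|k v|)) => // v _ vmax.
    have bv : `|(b v)%:~R| <= M%:R :> rat.
      by rewrite -intr_norm -[M%:R]/(M%:Z%:~R) ler_int.
    have := vmax u isT; have := vmax (w v) isT; rewrite /= => wv uv.
    have : `|k v| <= `|(b v)%:~R| + eps * `|k (w v)|.
      by rewrite {1}kE -[X in _ + X * _]gtr0_norm // -normrM ler_normB.
    have := normr_ge0 (k v); nra.
  move=> u v; have := kM u; have := kM v; rewrite !ler_norml => /andP[? ?] /andP[? ?].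
  by nra.
move=> x; rewrite /k /S -mulrN -sumrN; congr (_ * _); apply: eq_bigr => i _.
by rewrite hyperoct_expg // bN rmorphN mulrN.
Qed.

(** * Blocks cut out by a set of positions *)

(** Position j separates the integers j and j + 1. A new block starts at each position outside [D],
    so this numbers the block of [m], with 0 in block 0; [block] extends the numbering as an odd
    function. *)
Definition block_index n (D : {set 'I_n}) (m : nat) : nat :=
  #|[set j : 'I_n | (j < m)%N && (j \notin D)]|.

Definition block n (D : {set 'I_n}) (x : spt n) : int :=
  if x.1 then - (block_index D x.2.+1)%:Z else (block_index D x.2.+1)%:Z.

Definition block_stab n (D : {set 'I_n}) : {set {perm spt n}} :=
  [set s in hyperoct n | [forall x, block D (s x) == block D x]].

Definition desB_set n (w : {perm spt n}) : {set 'I_n} :=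
  [set i : 'I_n | sval_at w i.+1 < sval_at w i].

Lemma block_stabP n (D : {set 'I_n}) s :
  reflect (s \in hyperoct n /\ forall x, block D (s x) = block D x)
          (s \in block_stab D).
Proof.
rewrite [s \in block_stab D]in_set; apply: (iffP andP) => -[sH] sb; split=> //.
  by move=> x; apply/eqP/(forallP sb).
by apply/forallP => x; rewrite sb.
Qed.

Lemma block_opp n (D : {set 'I_n}) x : block D (spt_opp x) = - block D x.
Proof. by case: x => -[] i; rewrite /block /= ?opprK. Qed.

Lemma block_index_le n (D : {set 'I_n}) m m' :
  (m <= m')%N -> (block_index D m <= block_index D m')%N.
Proof.
move=> mm'; apply/subset_leq_card/subsetP => j; rewrite !inE.
by case/andP=> jm ->; rewrite (leq_trans jm).
Qed.

Lemma block_index0 n (D : {set 'I_n}) : block_index D 0 = 0%N.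
Proof. by apply: eq_card0 => j; rewrite inE. Qed.

Lemma block_indexS n (D : {set 'I_n}) (j : 'I_n) :
  (block_index D j == block_index D j.+1) = (j \in D).
Proof.
have [jD | jD] := boolP (j \in D).
  apply/eqP/eq_card => i; rewrite !inE ltnS [(i <= j)%N]leq_eqVlt.
  by case: eqVneq => [/val_inj -> | _] //=; rewrite jD ltnn.
apply/negbTE; rewrite neq_ltn proper_card //; apply/properP; split.
  by apply/subsetP => i; rewrite !inE => /andP[/leqW ->].
by exists j; rewrite !inE ?ltnS ?leqnn ?ltnn.
Qed.

Lemma block_index_eqP n (D : {set 'I_n}) m m' (j : 'I_n) :
  block_index D m = block_index D m' -> (m <= j)%N -> (j < m')%N -> j \in D.
Proof.
move=> E mj jm'; rewrite -block_indexS eqn_leq block_index_le //=.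
by rewrite (leq_trans (block_index_le _ jm')) // -E block_index_le.
Qed.

Lemma block_le n (D : {set 'I_n}) x y :
  spt_int x < spt_int y -> block D x <= block D y.
Proof.
case: x y => [a i] [c j]; rewrite /spt_int /block /=.
case: a; case: c => H.
- by rewrite lerN2 lez_nat block_index_le //; lia.
- lia.
- lia.
- by rewrite lez_nat block_index_le //; lia.
Qed.

Lemma block_bound n (D : {set 'I_n}) x : `|block D x| <= n%:Z.
Proof.
have H m : (block_index D m <= n)%N by rewrite -[X in (_ <= X)%N]card_ord max_card.
by have := H x.2.+1; rewrite /block; case: x.1; lia.
Qed.

(** The ordinal [i] stands for the point i + 1, which is joined to i by position i and to i + 2 by
    position i + 1; these are the points with such a link. *)
Definition block_support n (D : {set 'I_n}) : {set 'I_n} :=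
  D :|: [set i : 'I_n | [exists j in D, j == i.+1 :> nat]].

Lemma card_block_support n (D : {set 'I_n}) : (#|block_support D| <= 2 * #|D|)%N.
Proof.
rewrite mul2n -addnn (leq_trans (leq_card_setU _ _)) // leq_add2l.
case: n D => [|n] D; first by apply: leq_trans (max_card _) _; rewrite card_ord.
apply: leq_trans (leq_imset_card (fun j : 'I_n.+1 => inord j.-1 : 'I_n.+1) D).
apply/subset_leq_card/subsetP => i; rewrite inE => /exists_inP[j jD /eqP ji].
by apply/imsetP; exists j => //; apply: val_inj; rewrite ji /= inordK ?ltn_ord.
Qed.

(** A point outside the support is cut off on both sides. In particular its block number is not 0,
    which rules out sharing a block with a point of opposite sign. *)
Lemma block_eq_notin_support n (D : {set 'I_n}) x y :
  x.2 \notin block_support D -> block D x = block D y -> x = y.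
Proof.
case: x y => [a i] [c j]; rewrite !inE negb_or /block /= => /andP[iD iD'].
have opp : block_index D i.+1 = 0%N -> False.
  rewrite -(block_index0 D) => /esym/block_index_eqP/(_ (leq0n i))/(_ (leqnn _)).
  exact/negP.
have same : block_index D i.+1 = block_index D j.+1 -> i = j.
  move=> E; apply: ord_inj; case: (ltngtP i j) => // ij.
    have jn := leq_ltn_trans ij (ltn_ord j).
    have /negP[] := iD'; apply/exists_inP; exists (Ordinal jn) => //.
    exact: (block_index_eqP E).
  have /negP[] := iD; exact: (block_index_eqP (esym E)).
case: a; case: c => E.
- by rewrite same //; move: E; lia.
- by case: opp; move: E; lia.
- by case: opp; move: E; lia.
- by rewrite same //; move: E; lia.
Qed.

(** * Descents as order reversal on blocks *)

Lemma sval_at_spt n (w : {perm spt n}) (i : 'I_n) :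
  sval_at w i.+1 = spt_int (w (spt_pos i)).
Proof. by rewrite /sval_at valK. Qed.

(** Consecutive descents chain along a block. Block 0 is symmetric about 0, and there [w(0) = 0]
    forces positive points to have negative images. *)
Lemma sub_desB_setP n (D : {set 'I_n}) (w : {perm spt n}) :
  w \in hyperoct n ->
  reflect (forall x y, block D x = block D y -> spt_int x < spt_int y ->
             spt_int (w y) < spt_int (w x))
          (D \subset desB_set w).
Proof.
move=> /hyperoctP wN; have spt_neg i : (true, i) = spt_opp (spt_pos i) by [].
apply: (iffP subsetP) => [DS | H j jD].
  have decr m m' : (m' <= n)%N -> block_index D m = block_index D m' ->
      (m < m')%N -> sval_at w m' < sval_at w m.
    elim: m' => // m' IH m'n E mm'.
    have m'D : Ordinal m'n \in D by apply: (block_index_eqP E).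
    have := DS _ m'D; rewrite inE /= => lt.
    move: mm'; rewrite ltnS leq_eqVlt => /orP[/eqP-> // | mm'].
    apply: lt_trans lt (IH (ltnW m'n) _ mm').
    by rewrite E; apply/esym/eqP; rewrite -[m']/(val (Ordinal m'n)) block_indexS.
  have decr_pos (i j : 'I_n) : block_index D i.+1 = block_index D j.+1 ->
      (i < j)%N -> spt_int (w (spt_pos j)) < spt_int (w (spt_pos i)).
    by move=> E ij; rewrite -!sval_at_spt; apply: decr.
  have decr0 (i : 'I_n) : block_index D i.+1 = 0%N -> spt_int (w (spt_pos i)) < 0.
    by move=> E; rewrite -sval_at_spt; apply: (decr 0%N) => //; rewrite block_index0.
  case=> [a i] [c j] E lt; rewrite /block /spt_int /= in E lt.
  case: a E lt; case: c => /= E lt.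
  - by rewrite !spt_neg !wN !spt_int_opp ltrN2; apply: decr_pos; lia.
  - rewrite spt_neg wN spt_int_opp.
    have := decr0 i; have := decr0 j; rewrite /spt_pos.
    by move=> hj hi; apply: lt_trans (hj _) _; rewrite ?oppr_gt0 ?hi //; lia.
  - by exfalso; move: lt; lia.
  - by apply: decr_pos; lia.
(* Position 0 is tested on the points -1 and 1, both in block 0: w(1) < w(-1) = -w(1) says that w(1)
   is negative. *)
rewrite inE sval_at_spt; case: j jD => -[|j] jn jD.
  have := H (spt_opp (spt_pos (Ordinal jn))) (spt_pos (Ordinal jn)).
  rewrite wN spt_int_opp block_opp.
  have -> : block D (spt_pos (Ordinal jn)) = 0.
    rewrite /block /=; have := block_indexS D (Ordinal jn).
    by rewrite jD block_index0 => /eqP <-.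
  move=> /(_ (oppr0 _) isT); rewrite -[sval_at w _]/(0 : int).
  by rewrite spt_int_opp; lia.
rewrite -[val (Ordinal jn)]/(val (Ordinal (ltnW jn))).+1 sval_at_spt.
apply: H; last by rewrite /spt_int /=; lia.
have := block_indexS D (Ordinal jn); rewrite jD => /eqP E.
by rewrite /block /= E.
Qed.

(** * Exactly one sorting element in the block stabiliser *)

Lemma card_block_sorting n (D : {set 'I_n}) (k : spt n -> rat)
    (P : pred {perm spt n}) :
  injective k ->
  (forall x, k (spt_opp x) = - k x) ->
  (forall x y, block D x < block D y -> k x < k y) ->
  (forall s, s \in block_stab D ->
     (forall x y, (k x < k y) = (spt_int (s x) < spt_int (s y))) <-> P s) ->
  #|[set s in block_stab D | P s]| = 1%N.
Proof.
move=> kI kN bk HP.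
have [s sH [sb sk]] :=
  block_sorting_perm (@block_opp n D) (@block_le n D) kI kN bk.
have sD : s \in block_stab D by apply/block_stabP.
apply/eqP/cards1P; exists s; apply/setP => t; rewrite in_set1 in_set.
apply/andP/eqP => [[tD /(HP t tD) tk] | ->]; last by split=> //; apply/(HP s sD).
exact: (sorting_perm_unique (k := k) (@spt_int_inj n)).
Qed.

(** The converse implication is free by trichotomy, since [s] is injective. *)
Lemma descent_iff n (D : {set 'I_n}) (s : {perm spt n}) (f : spt n -> spt n) :
  (forall x y, block D x = block D y -> spt_int (s x) < spt_int (s y) ->
     spt_int (f y) < spt_int (f x)) ->
  forall x y, block D x = block D y ->
    (spt_int (s x) < spt_int (s y)) = (spt_int (f y) < spt_int (f x)).
Proof.
move=> H x y E; case: ltgtP => [lt | lt | /spt_int_inj/perm_inj ->].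
- by rewrite H.
- by rewrite (lt_gtF (H _ _ (esym E) lt)).
- by rewrite ltxx.
Qed.

Section StabSorting.
Variables (n : nat) (D : {set 'I_n}) (s : {perm spt n}).
Hypothesis sD : s \in block_stab D.

Lemma block_stab_lt x y :
  block D x != block D y ->
  (spt_int (s x) < spt_int (s y)) = (block D x < block D y).
Proof.
have /block_stabP[_ sb] := sD; rewrite neq_lt => /orP[] lt.
  rewrite lt; apply: contraLR lt; rewrite -!leNgt le_eqVlt => /orP[/eqP|].
    by move/spt_int_inj/perm_inj ->.
  by move/(@block_le n D); rewrite !sb.
rewrite (lt_gtF lt); apply: contraTF lt => /(@block_le n D).
by rewrite !sb -leNgt.
Qed.

(** As [s] preserves blocks, pairs [s x], [s y] run over all pairs in a common block, and [w ^ s]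
    sends [s x] to [s (w x)]. *)
Lemma sub_desB_set_conjP (w : {perm spt n}) :
  w \in hyperoct n ->
  (forall x y, block D x = block D y -> spt_int (s x) < spt_int (s y) ->
     spt_int (s (w y)) < spt_int (s (w x)))
  <-> D \subset desB_set (w ^ s)%g.
Proof.
have /block_stabP[sH sb] := sD => wH.
have wsH : (w ^ s)%g \in hyperoct n by rewrite groupJ.
split=> [H | /(sub_desB_setP D wsH) H x y E lt].
  apply/(sub_desB_setP D wsH) => x y; rewrite -[x](permKV s) -[y](permKV s) !sb !permJ.
  exact: H.
by have := H (s x) (s y); rewrite !permJ !sb; apply.
Qed.

Lemma sub_desB_set_mulP (w : {perm spt n}) :
  w \in hyperoct n ->
  (forall x y, block D x = block D y -> spt_int (s x) < spt_int (s y) ->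
     spt_int (w y) < spt_int (w x))
  <-> D \subset desB_set (s^-1 * w)%g.
Proof.
have /block_stabP[sH sb] := sD => wH.
have wsH : (s^-1 * w)%g \in hyperoct n by rewrite groupM // groupV.
split=> [H | /(sub_desB_setP D wsH) H x y E lt].
  apply/(sub_desB_setP D wsH) => x y; rewrite -[x](permKV s) -[y](permKV s) !sb !permM !permK.
  exact: H.
by have := H (s x) (s y); rewrite !permM !permK !sb; apply.
Qed.

End StabSorting.

(** The right [s] sorts by block first and, inside a block, by decreasing value of [w]. *)
Lemma card_stab_mul n (D : {set 'I_n}) (w : {perm spt n}) :
  w \in hyperoct n ->
  #|[set s in block_stab D | D \subset desB_set (s^-1 * w)%g]| = 1%N.
Proof.
move=> wH; have /hyperoctP wN := wH.
(* Values of [w] differ by at most 2n, so this weight keeps their effect below the gap 1 between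
   block numbers. *)
pose eps : rat := (2 * n%:R + 1)^-1.
have n0 : 0 <= n%:R :> rat by apply: ler0n.
have eps0 : 0 < eps by rewrite invr_gt0; lra.
have epsE : eps * (2 * n%:R + 1) = 1 by rewrite mulVf //; apply: lt0r_neq0; lra.
pose k x : rat := (block D x)%:~R - eps * (spt_int (w x))%:~R.
have eM (x : spt n) : - n%:R <= ((spt_int x)%:~R : rat) <= n%:R.
  rewrite -[n%:R]/(n%:Z%:~R) -mulrNz !ler_int /spt_int.
  by have := ltn_ord x.2; case: x.1; lia.
have bk x y : block D x < block D y -> k x < k y.
  move=> lt; have : (block D x)%:~R + 1 <= (block D y)%:~R :> rat.
    by rewrite -[1]/(1%:~R) -rmorphD ler_int; lia.
  have /andP[? ?] := eM (w x); have /andP[? ?] := eM (w y); rewrite /k; nra.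
have kb x y : block D x = block D y ->
    (k x < k y) = (spt_int (w y) < spt_int (w x)).
  by move=> E; rewrite /k E ltrD2l ltrN2 ltr_pM2l // ltr_int.
apply: (@card_block_sorting n D k) => //.
- move=> x y E; have bE : block D x = block D y.
    apply/eqP; rewrite eq_le !leNgt.
    by apply/andP; split; apply/negP => /bk; rewrite E ltxx.
  apply: (@perm_inj _ w); apply: spt_int_inj; apply/eqP.
  by rewrite eq_le !leNgt -!kb // E ltxx.
- by move=> x; rewrite /k wN spt_int_opp block_opp !rmorphN /=; ring.
move=> s sD; split=> [sk | /(sub_desB_set_mulP sD wH) H x y].
  by apply/(sub_desB_set_mulP sD wH) => x y E; rewrite -sk kb.
have [E | ne] := eqVneq (block D x) (block D y).
  by rewrite kb // (descent_iff H).
rewrite (block_stab_lt sD) //; move: ne; rewrite neq_lt => /orP[] lt.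
  by rewrite lt bk.
by rewrite (lt_gtF lt) (lt_gtF (bk _ _ lt)).
Qed.

(* Two distinct points are compared by following their [w]-orbits until these
   first lie in different blocks; the hypothesis makes this happen. *)
Lemma card_stab_conj n (D : {set 'I_n}) (w : {perm spt n}) :
  w \in hyperoct n ->
  (forall x, exists i, ((w ^+ i)%g x).2 \notin block_support D) ->
  #|[set s in block_stab D | D \subset desB_set (w ^ s)%g]| = 1%N.
Proof.
move=> wH wout; have /hyperoctP wN := wH.
have sep x y : x != y -> exists i, block D ((w ^+ i)%g x) != block D ((w ^+ i)%g y).
  move=> xy; have [i iout] := wout x; exists i; apply: contra xy => /eqP.
  by move/(block_eq_notin_support iout)/perm_inj ->.
have [eps [k [eps0 kE kM kN]]] :=
  alternating_key wH (@block_bound n D) (@block_opp n D).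
have bk x y : block D x < block D y -> k x < k y.
  move=> lt; have : (block D x)%:~R + 1 <= (block D y)%:~R :> rat.
    by rewrite -[1]/(1%:~R) -rmorphD ler_int; lia.
  by have := kM (w y) (w x); rewrite (kE x) (kE y); lra.
have kb x y : block D x = block D y -> (k x < k y) = (k (w y) < k (w x)).
  by move=> E; rewrite (kE x) (kE y) E ltrD2l ltrN2 ltr_pM2l.
have kne x y : block D x != block D y -> (k x < k y) = (block D x < block D y).
  rewrite neq_lt => /orP[] lt; first by rewrite lt bk.
  by rewrite (lt_gtF lt) (lt_gtF (bk _ _ lt)).
apply: (@card_block_sorting n D k) => //.
  move=> x y E; apply/eqP; apply: contraT => /sep[i].
  elim: i x y E => [|i IH] x y E.
    by rewrite expg0 !perm1 neq_lt => /orP[] /bk; rewrite E ltxx.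
  rewrite expgS !permM => /IH; apply.
  have [bE | ] := eqVneq (block D x) (block D y); last first.
    by rewrite neq_lt => /orP[] /bk; rewrite E ltxx.
  by apply/eqP; rewrite eq_le !leNgt -!kb // E ltxx.
move=> s sD; split=> [sk | /(sub_desB_set_conjP sD wH) H x y].
  by apply/(sub_desB_set_conjP sD wH) => x y E; rewrite -!sk kb.
have [-> | /sep[i]] := eqVneq x y; first by rewrite !ltxx.
(* Before separation, [k] and [s] both reverse order when passing to the images under [w]; after it,
   both follow the block numbers. Hence they agree. *)
elim: i x y => [|i IH] x y.
  by rewrite expg0 !perm1 => ne; rewrite kne // (block_stab_lt sD).
have [E | ne] := eqVneq (block D x) (block D y); last first.
  by rewrite kne // (block_stab_lt sD).
rewrite expgS !permM kb // (descent_iff (f := s \o w) H) //= => ne.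
by rewrite IH // eq_sym.
Qed.

(** * Double counting and the order of the group *)

(** Count pairs (s, x) with [P (f s x)]: each [x] gives one, and each [s] gives as many as [A] has
    points satisfying [P], because [f s] permutes [A]. *)
Lemma double_counting (S T : finType) (W : {set S}) (A : {set T})
    (f : S -> T -> T) (P : pred T) :
  (forall s, s \in W -> injective (f s)) ->
  (forall s x, s \in W -> x \in A -> f s x \in A) ->
  (forall x, x \in A -> #|[set s in W | P (f s x)]| = 1%N) ->
  (#|W| * #|[set x in A | P x]|)%N = #|A|.
Proof.
move=> fI fA f1; rewrite -[RHS]sum1_card.
transitivity (\sum_(x in A) \sum_(s in W) P (f s x))%N; last first.
  apply: eq_bigr => x /f1 <-; rewrite -sum1_card big_mkcond [RHS]big_mkcond /=.
  by apply: eq_bigr => s _; rewrite in_set; case: (s \in W); case: (P _).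
rewrite exchange_big /= -sum_nat_const; apply: eq_bigr => s sW.
have fAE : f s @: A = A :> {set T}.
  apply/eqP; rewrite eqEcard card_imset ?leqnn ?andbT; last exact: fI.
  by apply/subsetP => y /imsetP[x xA ->]; apply: fA.
have -> : [set x in A | P x] = f s @: [set x in A | P (f s x)].
  apply/setP => y; rewrite in_set -{1}fAE; apply/andP/imsetP.
    by case=> /imsetP[x xA ->] Px; exists x; rewrite ?in_set ?xA.
  by case=> x; rewrite in_set => /andP[xA Px] ->; rewrite imset_f.
rewrite card_imset; last exact: fI.
rewrite -sum1_card big_mkcond [RHS]big_mkcond /=.
by apply: eq_bigr => x _; rewrite in_set; case: (x \in A); case: (P _).
Qed.

Lemma card_hyperoct n : #|hyperoct n| = (2 ^ n * n`!)%N.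
Proof.
(* A signed permutation is encoded by the signs and the absolute values of its images of positive
   points. *)
pose f (u : {ffun 'I_n -> bool} * {perm 'I_n}) (x : spt n) : spt n :=
  (u.1 x.2 (+) x.1, u.2 x.2).
have fI u : injective (f u).
  by move=> [a i] [c j] [/[swap] /perm_inj <- /addbI <-].
pose F u := perm (@fI u).
have FI : injective F.
  move=> [b p] [b' p'] /permP E; have {}E i := E (spt_pos i).
  congr (_, _); [apply/ffunP => i | apply/permP => i]; move: (E i); rewrite !permE.
    by case=> /=; rewrite !addbF.
  by case.
have <- : F @: setT = hyperoct n.
  apply/setP => w; apply/imsetP/idP => [[u _ ->] | wH].
    by apply/hyperoctP => x; rewrite !permE /f /spt_opp /= addbN.
  exists ([ffun i => (w (spt_pos i)).1], abs_perm w) => //.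
  apply/permP => -[a i]; rewrite permE /f /= ffunE abs_permE //.
  have /hyperoctP wN := wH; case: a; last by rewrite addbF -surjective_pairing.
  by rewrite -[(true, i)]/(spt_opp (spt_pos i)) wN addbT.
rewrite card_imset // cardsT card_prod card_ffun card_bool card_ord.
by rewrite card_Sn.
Qed.

(** * Cycles and orbits *)

Lemma abs_perm_expg n (w : {perm spt n}) i x :
  w \in hyperoct n -> ((w ^+ i)%g x).2 = (abs_perm w ^+ i)%g x.2.
Proof.
move=> wH; have /hyperoctP wN := wH.
elim: i x => [|i IH] x; first by rewrite !expg0 !perm1.
rewrite !expgS !permM IH abs_permE //; congr (_ _); case: x => -[] j //.
by rewrite -[(true, j)]/(spt_opp (spt_pos j)) wN.
Qed.

(** The cycle through [x.2] has more elements than [S], so it cannot stay inside. *)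
Lemma orbit_escapes n (w : {perm spt n}) (S : {set 'I_n}) x :
  w \in hyperoct n -> (forall c, c \in cycles w -> (#|S| < #|c|)%N) ->
  exists i, ((w ^+ i)%g x).2 \notin S.
Proof.
move=> wH H; have /H : porbit (abs_perm w) x.2 \in cycles w by apply: imset_f.
rewrite ltnNge => nle; have /subsetPn[y] := contra (@subset_leq_card _ _ _) nle.
by case/porbitP => i -> yS; exists i; rewrite abs_perm_expg.
Qed.

Lemma cycle_type_mem n (w : {perm spt n}) (c : {set 'I_n}) :
  c \in cycles w -> (#|c| \in (cycle_type w).1) || (#|c| \in (cycle_type w).2).
Proof.
move=> cw; rewrite !mem_sort; have [o | o] := boolP (odd_cycle w c); apply/orP.
  by right; apply/mapP; exists c; rewrite // mem_filter o mem_enum.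
by left; apply/mapP; exists c; rewrite // mem_filter o mem_enum.
Qed.

Lemma cycle_gt0 n (w : {perm spt n}) (c : {set 'I_n}) :
  c \in cycles w -> (0 < #|c|)%N.
Proof. by case/imsetP => i _ ->; apply/card_gt0P; exists i; apply: porbit_id. Qed.

(** * Expansion in powers of t - 1 and conclusion *)

Lemma desB_poly_expand n (A : {set {perm spt n}}) :
  desB_poly A = 'X * \sum_(D : {set 'I_n})
    #|[set w in A | D \subset desB_set w]|%:R *: ('X - 1) ^+ #|D|.
Proof.
have E (w : {perm spt n}) : 'X^(desB w) =
    \sum_(D : {set 'I_n} | D \subset desB_set w) ('X - 1) ^+ #|D| :> {poly rat}.
  (* Expanding the product of the [F i + 1] over subsets leaves only those inside the descent set,
     as [F] vanishes elsewhere. *)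
  pose F (i : 'I_n) : {poly rat} := if i \in desB_set w then 'X - 1 else 0.
  transitivity (\prod_(i : 'I_n) (F i + 1)).
    rewrite -prodr_const [LHS]big_mkcond /=; apply: eq_bigr => i _; rewrite /F.
    by case: ifP => _; rewrite ?subrK ?add0r.
  rewrite bigA_distr [RHS]big_mkcond /=; apply: eq_bigr => D _.
  case: ifP => [/subsetP sub | /negbT/subsetPn[i iD iw]].
    rewrite -prodr_const [RHS]big_mkcond /=; apply: eq_bigr => i _.
    by case: ifP => // /sub; rewrite /F => ->.
  by rewrite (bigD1 i) //= iD /F (negbTE iw) mul0r.
rewrite /desB_poly mulr_sumr.
transitivity ('X * \sum_(w in A) \sum_(D : {set 'I_n} | D \subset desB_set w)
  ('X - 1 : {poly rat}) ^+ #|D|).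
  by rewrite mulr_sumr; apply: eq_bigr => w _; rewrite exprS E.
rewrite -mulr_sumr; congr (_ * _); rewrite (exchange_big_dep predT) //=.
apply: eq_bigr => D _; rewrite scaler_nat -sumr_const; apply: eq_bigl => w.
by rewrite in_set.
Qed.

Theorem theorem5p13 (n l : nat) (hn : (1 <= n)%N) (hl : (1 <= l)%N)
    (lam mu : seq nat) (C : {set {perm (spt n)}})
    (hC : conj_class_of_type lam mu C)
    (hcyc : forall k : nat, (1 <= k <= 2 * l)%N ->
      (k \notin lam) && (k \notin mu)) :
  exists g : {poly rat},
    (#|C|%:R)^-1 *: desB_poly C =
      ((2 ^ n * n`!)%:R)^-1 *: desB_poly (hyperoct n)
        + (1 - 'X) ^+ l.+1 * g.
Proof.
have [/imsetP[w0 w0H CE] Ctype] := hC.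
have CH w : w \in C -> w \in hyperoct n.
  by rewrite CE => /imsetP[t tH ->]; rewrite groupJ.
have Clong w c : w \in C -> c \in cycles w -> (2 * l < #|c|)%N.
  move=> wC cw; have := cycle_type_mem cw; rewrite (Ctype w wC) /=.
  apply: contraTT; rewrite -leqNgt => cl; rewrite negb_or.
  by apply: hcyc; rewrite cl (cycle_gt0 cw).
pose N (A : {set {perm spt n}}) (D : {set 'I_n}) := #|[set w in A | D \subset desB_set w]|.
have NB D : (#|block_stab D| * N (hyperoct n) D)%N = #|hyperoct n|.
  apply: (double_counting (f := fun s w => (s^-1 * w)%g)) => [s _|s w|w].
  - exact: mulgI.
  - by move=> /block_stabP[sH _] wH; rewrite groupM // groupV.
  - exact: card_stab_mul.
have NC (D : {set 'I_n}) : (#|D| <= l)%N -> (#|block_stab D| * N C D)%N = #|C|.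
  move=> Dl; apply: (double_counting (f := fun s w => (w ^ s)%g)) => [s _|s w|w].
  - exact: conjg_inj.
  - by move=> /block_stabP[sH _]; rewrite CE => /imsetP[t tH ->];
      rewrite -conjgM; apply: memJ_class; rewrite groupM.
  (* The support has at most 2 * #|D| <= 2l points, fewer than any cycle of [w], so every orbit
     leaves it. *)
  - move=> wC; apply: card_stab_conj (CH _ wC) _ => x.
    apply: orbit_escapes (CH _ wC) _ => c /(Clong _ _ wC).
    apply: leq_ltn_trans; apply: leq_trans (card_block_support D) _.
    by rewrite leq_mul2l Dl orbT.
have B0 : (0 < #|hyperoct n|)%N by apply: cardG_gt0.
have C0 : (0 < #|C|)%N by apply/card_gt0P; exists w0; rewrite CE class_refl.
pose r (D : {set 'I_n}) : rat :=
  #|C|%:R^-1 * (N C D)%:R - #|hyperoct n|%:R^-1 * (N (hyperoct n) D)%:R.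
(* By [NB] and [NC] both proportions are the inverse of the order of [block_stab D]. *)
have r0 (D : {set 'I_n}) : (#|D| <= l)%N -> r D = 0.
  move=> /NC EC; have EB := NB D.
  have W0 : (0 < #|block_stab D|)%N by move: C0; rewrite -EC muln_gt0 => /andP[].
  have NC0 : (0 < N C D)%N by move: C0; rewrite -EC muln_gt0 => /andP[].
  have NB0 : (0 < N (hyperoct n) D)%N by move: B0; rewrite -EB muln_gt0 => /andP[].
  by rewrite /r -EC -EB !natrM; field; rewrite !pnatr_eq0 -!lt0n W0 NC0 NB0.
(* Only sets with more than [l] positions survive; (t - 1)^|D| is rewritten as (-1)^|D| (1 - t)^|D|,
   from which l + 1 factors are taken out. *)
exists ('X * \sum_(D : {set 'I_n} | (l < #|D|)%N)
  r D *: ((-1) ^+ #|D| * (1 - 'X) ^+ (#|D| - l.+1))).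
rewrite -card_hyperoct addrC; apply/eqP; rewrite -subr_eq; apply/eqP.
rewrite !desB_poly_expand !scalerAr -mulrBr mulrCA; congr (_ * _).
rewrite !scaler_sumr -sumrB mulr_sumr [RHS]big_mkcond /=.
apply: eq_bigr => D _; rewrite !scalerA -scalerBl -/(r D).
case: ltnP => [lD | /r0 ->]; last by rewrite scale0r.
rewrite -scalerAr mulrCA -exprD subnKC // -exprMn; congr (_ *: _ ^+ _).
by rewrite mulN1r opprB.
Qed.
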